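(* Let $R$ be a von Neumann regular commutative ring with $1\neq 0$ and let $I$ be a nonzero ideal of $R$. Then the following statements are equivalent. (1) $I$ is a weakly 1-absorbing primary ideal of $R$. (2) $I$ is a primary ideal of $R$. (3) $I$ is a 1-absorbing primary ideal of $R$.
   Context: All rings are commutative with $1\neq 0$. A ring $R$ is von Neumann regular if for every $x\in R$ there is $y\in R$ with $x^2y=x$. For an ideal $I$ of $R$, $\sqrt{I}=\{a\in R : a^n\in I \text{ for some positive integer } n\}$. A proper ideal $I$ of $R$ is called weakly 1-absorbing primary if whenever $a,b,c\in R$ are nonunit elements and $0\neq abc\in I$, then $ab\in I$ or $c\in\sqrt{I}$. A proper ideal $I$ of $R$ is called 1-absorbing primary if whenever $a,b,c\in R$ are nonunit elements and $abc\in I$, then $ab\in I$ or $c\in\sqrt{I}$. Primary ideals are proper by definition. *)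

(* Defs.v *)
From mathcomp Require Import all_boot all_algebra.
From mathcomp Require Import boolp classical_sets.

Set Implicit Arguments.
Unset Strict Implicit.
Unset Printing Implicit Defensive.

Import GRing.Theory.

Local Open Scope classical_set_scope.
Local Open Scope ring_scope.

Definition von_neumann_regular (R : comNzRingType) : Prop :=
  forall x : R, exists y : R, x ^+ 2 * y = x.

(* Stated on comNzRingType, so that the ring need not carry a boolean unit
   predicate and a chosen inverse, as a comUnitRingType does. *)
Definition is_unit (R : comNzRingType) (x : R) : Prop :=
  exists y : R, x * y = 1.

(* The idealr structure of ring_quotient is restricted to proper ideals given
   by a boolean predicate; here an ideal is an arbitrary subset, possibly the
   whole ring. *)
Definition is_ideal (R : comNzRingType) (I : set R) : Prop :=
  [/\ I 0,
      forall a b : R, I a -> I b -> I (a + b)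
    & forall r a : R, I a -> I (r * a)].

Definition is_proper_ideal (R : comNzRingType) (I : set R) : Prop :=
  is_ideal I /\ I <> setT.

Definition radical (R : comNzRingType) (I : set R) : set R :=
  [set a : R | exists2 n : nat, (0 < n)%N & I (a ^+ n)].

Definition primary_ideal (R : comNzRingType) (I : set R) : Prop :=
  is_proper_ideal I /\
  forall a b : R, I (a * b) -> I a \/ radical I b.

Definition one_absorbing_primary (R : comNzRingType) (I : set R) : Prop :=
  is_proper_ideal I /\
  forall a b c : R, ~ is_unit a -> ~ is_unit b -> ~ is_unit c ->
    I (a * b * c) -> I (a * b) \/ radical I c.

Definition weakly_one_absorbing_primary (R : comNzRingType) (I : set R)
    : Prop :=
  is_proper_ideal I /\
  forall a b c : R, ~ is_unit a -> ~ is_unit b -> ~ is_unit c ->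
    a * b * c <> 0 -> I (a * b * c) -> I (a * b) \/ radical I c.

(* Main.v *)
(* In a von Neumann regular ring every ideal is radical.  A nonzero ideal I
   contains an idempotent e <> 0.  If ab lies in I, replace a and b by the
   congruent elements a(1-e)+e and b(1-e)+e: their product lies in I and is
   nonzero, since multiplication by e sends it to e.  So in testing primality
   one may assume ab <> 0; then a^2 b <> 0 by regularity, and the weak condition
   applies to the factors a, a, b. *)
Require Import Defs.
From mathcomp Require Import all_boot all_algebra.
From mathcomp Require Import boolp classical_sets.
From mathcomp Require Import ring.

Import GRing.Theory.

Local Open Scope classical_set_scope.
Local Open Scope ring_scope.

Section Ideals.
Context {R : comNzRingType}.
Implicit Types (I : set R) (a b x y : R).

(** Exhibits [x] as a multiple of each of its positive powers, so an ideal containing such a power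
    contains [x]. *)
Lemma regular_expr x y : x ^+ 2 * y = x -> forall n, x ^+ n.+1 * y ^+ n = x.
Proof.
move=> xyx; elim=> [|n IHn]; first by rewrite expr1 expr0 mulr1.
by rewrite (exprSr x) (exprSr y) mulrACA IHn mulrA -expr2.
Qed.

Lemma regular_radical I : von_neumann_regular R -> is_ideal I ->
  radical I `<=` I.
Proof.
move=> hR [_ _ IM] x [[//|n] _ Ixn]; have [y xyx] := hR x.
by rewrite -(regular_expr _ _ xyx n) mulrC; apply: IM.
Qed.

Lemma regular_idempotent I : von_neumann_regular R -> is_ideal I ->
  I <> [set 0] -> exists e, [/\ I e, e != 0 & e * e = e].
Proof.
move=> hR [I0 _ IM] /eqP I_neq0.
have [i Ii /eqP i_neq0] : exists2 i, I i & i <> 0.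
  apply: contrapT => noi; move/eqP: I_neq0; apply; apply/seteqP.
  split=> [i Ii|_ ->//]; apply: contrapT => i_neq0; apply: noi.
  by exists i.
(* From [i ^+ 2 * y = i], the element [y * i] is idempotent, and it is nonzero because [i] is a
   multiple of it. *)
have [y iyi] := hR i; exists (y * i); split; first exact: IM.
  apply: contra i_neq0 => /eqP yi0.
  by rewrite -iyi expr2 -mulrA [i * y]mulrC yi0 mulr0.
by rewrite -[in RHS]iyi; ring.
Qed.

Lemma ideal_unitM I a b : is_ideal I -> is_unit a -> I (a * b) -> I b.
Proof.
move=> [_ _ IM] [u au] /(IM u).
by rewrite mulrA [u * a]mulrC au mul1r.
Qed.

Lemma weakly_regular_neq0 I a b : von_neumann_regular R ->
  weakly_one_absorbing_primary I -> a * b <> 0 -> I (a * b) -> I a \/ I b.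
Proof.
move=> hR [[Iid _] Iweak] ab_neq0 Iab.
(* The weak condition speaks only of nonunits; a unit factor can be cancelled, leaving the other one
   in [I]. *)
have [ua|nua] := pselect (is_unit a); first by right; apply: ideal_unitM ua Iab.
have [ub|nub] := pselect (is_unit b).
  by left; apply: ideal_unitM ub _; rewrite // mulrC.
(* With [a ^+ 2 * y = a], the product [a * b] is a multiple of [a * a * b]. *)
have aab_neq0 : a * a * b <> 0.
  move=> aab0; apply: ab_neq0; have [y aya] := hR a.
  by rewrite -aya expr2 mulrAC aab0 mul0r.
have Iaab : I (a * a * b) by case: Iid => _ _ IM; rewrite -mulrA; apply: IM.
have [Iaa|Ib] := Iweak _ _ _ nua nua nub aab_neq0 Iaab.
  by left; apply: regular_radical => //; exists 2%N; rewrite ?expr2.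
by right; apply: regular_radical.
Qed.

Lemma weakly_regular_primary I : von_neumann_regular R -> I <> [set 0] ->
  weakly_one_absorbing_primary I -> primary_ideal I.
Proof.
move=> hR I_neq0 Iweak; have [Iproper _] := Iweak.
have [Iid _] := Iproper; have [_ ID IM] := Iid.
have [e [Ie /eqP e_neq0 ee]] := regular_idempotent I hR Iid I_neq0.
have shift x : I (x * (1 - e) + e) -> I x.
  move=> Ix; have -> : x = x * (1 - e) + e + (x - 1) * e by ring.
  by apply: ID => //; apply: IM.
split=> // a b Iab.
(* The first summand lies in [I] through [a * b], the second through [e]. *)
have prodE : (a * (1 - e) + e) * (b * (1 - e) + e)
    = (1 - e) ^+ 2 * (a * b) + ((a + b) * (1 - e) + e) * e by ring.
(* Since [e * (1 - e) = 0], [e] absorbs each factor in turn. *)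
have eprodE : e * ((a * (1 - e) + e) * (b * (1 - e) + e)) = e.
  have absorb x : e * (x * (1 - e) + e) = e.
    by rewrite mulrDr mulrCA mulrBr mulr1 ee subrr mulr0 add0r.
  by rewrite mulrA !absorb.
have prod_neq0 : (a * (1 - e) + e) * (b * (1 - e) + e) <> 0.
  by move=> prod0; apply: e_neq0; rewrite -eprodE prod0 mulr0.
have Iprod : I ((a * (1 - e) + e) * (b * (1 - e) + e)).
  by rewrite prodE; apply: ID; apply: IM.
have [/shift Ia|/shift Ib] := weakly_regular_neq0 _ _ _ hR Iweak prod_neq0 Iprod.
  by left.
by right; exists 1%N.
Qed.

(** The primary condition is applied to the two factors [a * b] and [c]. *)
Lemma primary_one_absorbing I : primary_ideal I -> one_absorbing_primary I.
Proof. by move=> [Iproper Iprim]; split=> // a b c _ _ _; apply: Iprim. Qed.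

Lemma one_absorbing_weakly I :
  one_absorbing_primary I -> weakly_one_absorbing_primary I.
Proof. by move=> [Iproper Iabs]; split=> // a b c ua ub uc _; apply: Iabs. Qed.

End Ideals.

Theorem theorem4 (R : comNzRingType) (hR : von_neumann_regular R)
    (I : set R) (hI : is_ideal I) (hI0 : I <> [set 0]) :
  (weakly_one_absorbing_primary I <-> primary_ideal I) /\
  (primary_ideal I <-> one_absorbing_primary I).
Proof.
have weakP : weakly_one_absorbing_primary I -> primary_ideal I.
  exact: weakly_regular_primary.
split; split=> //.
- by move/primary_one_absorbing/one_absorbing_weakly.
- exact: primary_one_absorbing.
- by move/one_absorbing_weakly.
Qed.
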